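(* For $n,d,r\in\mathbb N$ with $d\ge 2$ and $r\le d-1$, there exists an $(n,d,r,1)$ Latin hypercube.
   Context: A $d$-dimensional hypercube of order $n$ is an array whose cells are indexed by $[n]^d$. An $\ell$-layer is the sub-array obtained by fixing $d-\ell$ coordinates and letting the other $\ell$ vary. For $0\le t\le d-r$, an $(n,d,r,t)$ Latin hypercube is a $d$-dimensional hypercube of order $n$ with entries from a set of $n^r$ symbols such that every $(d-t)$-layer contains each symbol exactly $n^{d-r-t}$ times. *)

(* Defs.v *)
From mathcomp Require Import all_boot.
Set Implicit Arguments.
Unset Strict Implicit.
Unset Printing Implicit Defensive.

Definition cell (n d : nat) := {ffun 'I_d -> 'I_n}.

Definition hypercube (n d : nat) (S : finType) := {ffun cell n d -> S}.

(* The partial assignment [p] fixes coordinate [i] to the value [v] when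
   [p i = Some v], and lets it vary when [p i = None]. *)
Definition layer (n d : nat) (p : {ffun 'I_d -> option 'I_n}) :
    {set cell n d} :=
  [set x : cell n d | [forall i, (p i == None) || (p i == Some (x i))]].

Definition is_layer (n d l : nat) (L : {set cell n d}) : Prop :=
  exists2 p : {ffun 'I_d -> option 'I_n},
    #|[set i | p i == None]| = l & L = layer p.

(* The condition [r + t <= d] is 0 <= t <= d - r without truncated
   subtraction; it also makes the subtractions below exact. *)
Definition is_latin_hypercube (n d r t : nat) (S : finType)
    (H : hypercube n d S) : Prop :=
  [/\ r + t <= d,
      #|S| = n ^ r
    & forall L : {set cell n d}, is_layer (d - t) L ->
      forall s : S, #|[set x in L | H x == s]| = n ^ (d - r - t)].

(* Main.v *)
Require Import Defs.
From mathcomp Require Import all_boot.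
From mathcomp Require Import ssralg zmodp.
Set Implicit Arguments.
Unset Strict Implicit.
Unset Printing Implicit Defensive.

(** Over [Z/n], colour the cell [x] by the differences [x_j - x_last], [j < r].
    The shear [x |-> y] with [y_j = x_j - x_last] for [j < r] and [y_j = x_j]
    otherwise is a bijection of the cells.  It turns a colour class into
    "[y_j = s_j] for [j < r]"; inside that class, fixing one coordinate of [x]
    amounts to fixing a single coordinate [y_k] with [r <= k].  So each symbol
    is counted by the free choice of the remaining [d - r - 1] coordinates. *)

Lemma is_layer_hyperplane (n d : nat) (L : {set cell n d.+1}) :
  is_layer d L -> exists i v, L = [set x : cell n d.+1 | x i == v].
Proof.
case=> p card_free ->.
have card_fixed : #|~: [set i | p i == None]| == 1.
  have := cardsC [set i | p i == None]; rewrite card_free card_ord => card_sum.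
  by rewrite -(eqn_add2l d) card_sum addn1.
have [i fixed_i] := cards1P card_fixed.
have p_fixed j : (p j != None) = (j == i).
  by have := in_set1 j i; rewrite -fixed_i !inE.
case def_v: (p i) (p_fixed i) => [v|]; last by rewrite !eqxx.
move=> _; exists i, v; apply/setP=> x; rewrite !inE.
apply/forallP/eqP=> [/(_ i) | xi j].
  by rewrite def_v => /eqP[].
have [->|ne_ji] := eqVneq j i; first by rewrite def_v xi eqxx orbT.
by move: (p_fixed j); rewrite (negbTE ne_ji) => /negbFE ->.
Qed.

(** These functions form a product of fibres, a singleton over each index in [A] and all of [T]
    elsewhere. *)
Lemma card_ffun_prescribed (I T : finType) (A : {set I}) (s : I -> T) :
  #|[set y : {ffun I -> T} | [forall (i | i \in A), y i == s i]]|
    = #|T| ^ #|~: A|.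
Proof.
pose F i : pred T := if i \in A then pred1 (s i) else predT.
transitivity #|(family F : pred {ffun I -> T})|.
  apply: eq_card => y; rewrite inE; apply/forallP/familyP=> yF i.
    by have /implyP := yF i; rewrite /F; case: (i \in A) => //; apply.
  by apply/implyP=> Ai; have := yF i; rewrite /F Ai.
rewrite card_family foldrE big_map big_enum /= (bigID [in A]) /=.
rewrite big1 ?mul1n => [|i Ai]; last by rewrite /F Ai card1.
rewrite (eq_bigr (fun=> #|T|)) => [|i nAi]; last by rewrite /F (negbTE nAi).
by rewrite prod_nat_const; congr (_ ^ _); apply: eq_card => i; rewrite !inE.
Qed.

Section Shear.
Import GRing.Theory.
Local Open Scope ring_scope.

Variables (n d r : nat).
Hypothesis le_rd : (r <= d)%N.
Local Notation point := (cell n.+1 d.+1).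

Definition shear (x : point) : point :=
  [ffun j : 'I_d.+1 => if (j < r)%N then x j - x ord_max else x j].

Definition unshear (y : point) : point :=
  [ffun j : 'I_d.+1 => if (j < r)%N then y j + y ord_max else y j].

Lemma ord_max_ge : (d < r)%N = false.
Proof. by rewrite ltnNge le_rd. Qed.

(** As [r <= d], the last coordinate is not sheared, so the subtracted amount can still be read off
    the image. *)
Lemma shearK : cancel shear unshear.
Proof.
move=> x; apply/ffunP=> j; rewrite !ffunE /= ord_max_ge.
by case: (j < r)%N; rewrite ?subrK.
Qed.

Definition difference_cube : hypercube n.+1 d.+1 {ffun 'I_r -> 'I_n.+1} :=
  [ffun x : point =>
    [ffun j : 'I_r => x (widen_ord (leqW le_rd) j) - x ord_max]].

Lemma difference_cubeE (x : point) (s : {ffun 'I_r -> 'I_n.+1}) :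
  (difference_cube x == s) =
    [forall j : 'I_r, shear x (widen_ord (leqW le_rd) j) == s j].
Proof.
apply/eqP/forallP=> [<- j | xs].
  by rewrite !ffunE /= ltn_ord.
by apply/ffunP=> j; have /eqP := xs j; rewrite !ffunE /= ltn_ord.
Qed.

Lemma card_difference_fiber (i : 'I_d.+1) (v : 'I_n.+1)
    (s : {ffun 'I_r -> 'I_n.+1}) :
  #|[set x : point | (x i == v) && (difference_cube x == s)]|
    = (n.+1 ^ (d - r))%N.
Proof.
pose w := widen_ord (leqW le_rd).
have [k ge_kr [u fixE]] : exists2 k : 'I_d.+1, (r <= k)%N & exists u,
    forall x : point, difference_cube x == s -> (x i == v) = (shear x k == u).
  (* If [r <= i], the shear leaves coordinate [i] alone. If [i < r], the colour forces
     [x i - x ord_max] to be [s i], so [x i = v] amounts to [x ord_max = v - s i], and the last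
     coordinate is unsheared. *)
  have [lt_ir | ge_ir] := ltnP i r; last first.
    by exists i => //; exists v => x _; rewrite ffunE ltnNge ge_ir.
  exists ord_max => //; exists (v - s (Ordinal lt_ir)) => x.
  rewrite difference_cubeE => /forallP/(_ (Ordinal lt_ir)).
  have -> : widen_ord (leqW le_rd) (Ordinal lt_ir) = i by apply: val_inj.
  move=> /eqP <-; rewrite !ffunE lt_ir /= ord_max_ge.
  rewrite opprB addrCA -[X in X == _ + _]addr0 (inj_eq (addrI _)).
  by rewrite [RHS]eq_sym subr_eq0 eq_sym.
pose A := k |: [set w j | j in 'I_r].
(* On [A] the default [u] is reached only at [k], because [r <= k]. *)
pose g (j : 'I_d.+1) := if insub (val j) is Some j' then s j' else u.
have gw j : g (w j) = s j by rewrite /g /= valK.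
have gk : g k = u by rewrite /g insubN // -leqNgt.
have cardA : #|~: A| = (d - r)%N.
  have kNw : k \notin [set w j | j in 'I_r].
    by apply/imsetP=> -[j _ def_k]; rewrite def_k leqNgt /= ltn_ord in ge_kr.
  have inj_w : injective w by move=> j j' /(congr1 val) /= /val_inj.
  by rewrite cardsCs setCK card_ord cardsU1 kNw card_imset // card_ord.
rewrite -cardA -[in RHS](card_ord n.+1) -(card_ffun_prescribed A g).
(* Pulling back along an injective self-map of a finite set preserves cardinality. *)
rewrite -[RHS](card_preimset _ (can_inj shearK)).
apply: eq_card => x; rewrite !inE.
apply/andP/forallP=> [[xi xs] j | xA].
  apply/implyP=> /setU1P[-> | /imsetP[j' _ ->]]; first by rewrite gk -fixE.
  by rewrite gw; move: xs; rewrite difference_cubeE => /forallP.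
(* The colour comes first, since [fixE] holds only inside the colour class. *)
have xs : difference_cube x == s.
  rewrite difference_cubeE; apply/forallP=> j; rewrite -gw.
  by apply: (implyP (xA _)); rewrite setU1r ?imset_f.
by rewrite fixE // -gk; split=> //; apply: (implyP (xA _)); rewrite setU11.
Qed.

End Shear.

Theorem theorem5p1 (n d r : nat) (hd : 2 <= d) (hr : r <= d - 1) :
  exists (S : finType) (H : hypercube n d S), is_latin_hypercube r 1 H.
Proof.
case: d hd hr => // d _; rewrite subn1 /= => le_rd.
exists {ffun 'I_r -> 'I_n}.
(* Order 0 is apart because the differences need the additive group on ['I_n.+1]. There the count is
   vacuous: a layer would fix a coordinate to a value in the empty ['I_0]. *)
case: n => [|n].
  exists [ffun x : cell 0 d.+1 => [ffun=> x ord0]].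
  split; rewrite ?addn1 ?card_ffun ?card_ord // subn1 /=.
  by move=> L /is_layer_hyperplane[i [[]]].
exists (difference_cube n le_rd).
split; rewrite ?addn1 ?card_ffun ?card_ord // subn1 /=.
move=> L /is_layer_hyperplane[i [v ->]] s.
rewrite subnAC subn1 -(card_difference_fiber le_rd i v s).
by apply: eq_card => x; rewrite !inE.
Qed.
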